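(* Let $\mu \in \mathbb{R}$ and $\sigma \in \mathbb{R}_{>0}$, and let $f : \mathbb{R} \to \mathbb{R}$ be given by $$f(x) = \frac{1}{\sqrt{2\pi\sigma^2}} \exp\Big(-\frac{1}{2\sigma^2}(x-\mu)^2\Big).$$ For $h \in \mathbb{R}$ let $g(x) = f(x-h)$, and for $\ell, u \in \mathbb{R}$ let $\mathcal{S} = \mathbb{R} \setminus (\ell, u)$. Then, for all $h \in \mathbb{R}_{>0}$ and all $\ell, u \in \mathbb{R}$ such that $u > \ell$, $$\langle g \rangle_{\mathcal{S}} > \langle f \rangle_{\mathcal{S}}.$$
   Context: For a function $f : \mathbb{R} \to \mathbb{R}$ and a set $\mathcal{S} \subseteq \mathbb{R}$, the centroid of $f$ under the support $\mathcal{S}$ is $$\langle f \rangle_{\mathcal{S}} = \frac{1}{\int_{\mathcal{S}} f(x)\,dx} \cdot \int_{\mathcal{S}} x f(x)\,dx.$$ When $f$ is the probability density function of a random variable $X$, this is the conditional expectation $\mathbb{E}[X \mid X \in \mathcal{S}]$. Here $(\ell,u)$ denotes the open interval, so $\mathbb{R}\setminus(\ell,u) = (-\infty,\ell] \cup [u,\infty)$. *)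

(* Defs.v *)
From mathcomp Require Import all_boot all_order all_algebra.
From mathcomp Require Import all_classical all_reals all_analysis.
Import numFieldNormedType.Exports.

Set Implicit Arguments.
Unset Strict Implicit.
Unset Printing Implicit Defensive.

Local Open Scope classical_set_scope.
Local Open Scope ring_scope.

(* Both integrals are the real-valued [Rintegral], so the value is meaningful
   when [f] and [x |-> x * f x] are Lebesgue-integrable on [S] and the integral
   of [f] over [S] is nonzero; it is unspecified junk otherwise. *)
Definition centroid (R : realType) (f : R -> R) (S : set R) : R :=
  1 / (\int[lebesgue_measure]_(x in S) f x) *
  \int[lebesgue_measure]_(x in S) (x * f x).

(* Main.v *)
Require Import Defs.
From mathcomp Require Import all_boot all_order all_algebra.
From mathcomp Require Import all_classical all_reals all_analysis.
From mathcomp Require Import measurable_realfun.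
From mathcomp Require Import ring lra.
Import Order.TTheory GRing.Theory Num.Theory.
Import numFieldNormedType.Exports.

Set Implicit Arguments.
Unset Strict Implicit.
Unset Printing Implicit Defensive.

Local Open Scope classical_set_scope.
Local Open Scope ring_scope.

(** Shifting a normal density to the right by h multiplies it by a positive
constant times [exp (h x / sigma^2)], an increasing function of x
([normal_pdf_tilt]).  Reweighting a positive mass density f on a set S of
positive measure by an increasing factor r moves the centroid m to the right:
since
[\int_S (x - m) f = 0],
[[
  \int_S (x - m) g = \int_S (x - m) (r x - r m) f,    where g = r f,
]]
and the integrand on the right is positive except at x = m, so that
[m * \int_S g < \int_S x g] ([centroid_lt_of_increasing_ratio]).
This applies to the complement of an interval because it contains a half-line
and so has positive measure ([lebesgue_measure_setDitv_gt0]).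

The same tilting identity shows that the normal densities have a first moment:
[|x|] is at most [exp x + exp (- x)], and each of these exponentials times a
normal density is a multiple of another normal density. *)

Section integrable_EFin.
Context d (T : measurableType d) (R : realType).
Variables (mu : {measure set T -> \bar R}) (D : set T).
Hypothesis mD : measurable D.

Lemma integrable_EFinZl (c : R) (p : T -> R) :
  mu.-integrable D (EFin \o p) -> mu.-integrable D (EFin \o (fun x => c * p x)).
Proof. by move=> pint; have := integrableZl mD c pint; exact: eq_integrable. Qed.

Lemma integrable_EFinD (p q : T -> R) :
  mu.-integrable D (EFin \o p) -> mu.-integrable D (EFin \o q) ->
  mu.-integrable D (EFin \o (fun x => p x + q x)).
Proof.
by move=> pint qint; have := integrableD mD pint qint; exact: eq_integrable.
Qed.

Lemma integrable_EFinB (p q : T -> R) :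
  mu.-integrable D (EFin \o p) -> mu.-integrable D (EFin \o q) ->
  mu.-integrable D (EFin \o (fun x => p x - q x)).
Proof.
by move=> pint qint; have := integrableB mD pint qint; exact: eq_integrable.
Qed.

End integrable_EFin.

(** A nonnegative function with zero integral vanishes almost everywhere; if it
is also nonzero almost everywhere on D, then D is negligible. *)
Lemma Rintegral_gt0 d (T : measurableType d) (R : realType)
    (mu : {measure set T -> \bar R}) (D : set T) (f : T -> R) :
  measurable D -> (0 < mu D)%E -> mu.-integrable D (EFin \o f) ->
  (forall x, D x -> 0 <= f x) -> {ae mu, forall x, D x -> f x != 0} ->
  0 < \int[mu]_(x in D) f x.
Proof.
move=> mD D0 intf f0 fn0.
rewrite lt0r Rintegral_ge0// andbT; apply/eqP => If0.
have If0E : (\int[mu]_(x in D) `|(EFin \o f) x| = 0)%E.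
  under eq_integral => x /set_mem Dx do rewrite /= ger0_norm ?f0//.
  rewrite -[LHS]fineK ?integrable_fin_num//.
  by move: If0; rewrite /Rintegral => ->.
have fE0 : ae_eq mu D (EFin \o f) (cst 0%E).
  by apply/(ae_eq_integral_abs mu mD) => //; exact: measurable_int intf.
have negD : mu.-negligible D.
  have : {ae mu, forall x, ~ D x}.
    apply: filterS2 fn0 fE0 => x fx0 fxE Dx.
    by have /eqP := fx0 Dx; apply; have [] := fxE Dx.
  by apply: negligibleS => x Dx /=; apply.
by move/measure_negligible : negD => /(_ mD) muD0; rewrite muD0 ltxx in D0.
Qed.

(** With m the centroid of f, subtracting [r m * (x - m) * f x], whose integral
is zero, from [(x - m) * g x] leaves [(x - m) * (r x - r m) * f x], where the
first two factors have the same sign.  The domain S has type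
[set (measurableTypeR R)] rather than [set R] so that its measurability refers
to the same sigma-algebra as [lebesgue_measure]. *)
Lemma centroid_lt_of_increasing_ratio (R : realType) (S : set (measurableTypeR R))
    (f g r : R -> R) :
  measurable S -> (0 < lebesgue_measure S)%E ->
  lebesgue_measure.-integrable S (EFin \o f) ->
  lebesgue_measure.-integrable S (EFin \o (fun x => x * f x)) ->
  lebesgue_measure.-integrable S (EFin \o g) ->
  lebesgue_measure.-integrable S (EFin \o (fun x => x * g x)) ->
  (forall x, S x -> 0 < f x) -> (forall x, S x -> 0 < g x) ->
  (forall x, S x -> g x = r x * f x) -> {homo r : x y / x < y} ->
  centroid f S < centroid g S.
Proof.
move=> mS S0 fint xfint gint xgint f0 g0 grf r_incr.
have I0 p : lebesgue_measure.-integrable S (EFin \o p) ->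
    (forall x, S x -> 0 < p x) -> 0 < \int[lebesgue_measure]_(x in S) p x.
  move=> pint p0; apply: Rintegral_gt0 => // [x Sx|]; first exact/ltW/p0.
  by apply: aeW => x Sx; rewrite gt_eqF// p0.
have F0 := I0 f fint f0; have G0 := I0 g gint g0.
set m := centroid f S.
have mE : \int[lebesgue_measure]_(x in S) (x * f x) =
    m * \int[lebesgue_measure]_(x in S) f x.
  by rewrite /m /centroid; field; rewrite gt_eqF.
have centered_int p : lebesgue_measure.-integrable S (EFin \o p) ->
    lebesgue_measure.-integrable S (EFin \o (fun x => x * p x)) ->
    lebesgue_measure.-integrable S (EFin \o (fun x => x * p x - m * p x)).
  move=> pint xpint; apply: (integrable_EFinB mS xpint).
  exact: (integrable_EFinZl mS m pint).
have centeredE p : lebesgue_measure.-integrable S (EFin \o p) ->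
    lebesgue_measure.-integrable S (EFin \o (fun x => x * p x)) ->
    \int[lebesgue_measure]_(x in S) (x * p x - m * p x) =
    \int[lebesgue_measure]_(x in S) (x * p x) -
    m * \int[lebesgue_measure]_(x in S) p x.
  by move=> pint xpint; rewrite RintegralB ?RintegralZl//;
    exact: (integrable_EFinZl mS m pint).
have rm_int := integrable_EFinZl mS (r m) (centered_int f fint xfint).
have : 0 < \int[lebesgue_measure]_(x in S)
    ((x * g x - m * g x) - r m * (x * f x - m * f x)).
  have prodE x : S x -> (x * g x - m * g x) - r m * (x * f x - m * f x) =
      (x - m) * (r x - r m) * f x by move=> Sx; rewrite grf//; ring.
  apply: Rintegral_gt0 => //.
  - exact: (integrable_EFinB mS (centered_int g gint xgint) rm_int).
  - move=> x Sx; rewrite prodE// mulr_ge0 ?(ltW (f0 _ Sx))//.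
    have [xm|mx|->] := ltgtP x m; last by rewrite subrr mul0r.
    + by rewrite mulr_le0// subr_le0 ltW// r_incr.
    + by rewrite mulr_ge0// subr_ge0 ltW// r_incr.
  - (* The integrand vanishes at most at the single point m. *)
    exists [set m]; split => //; first exact: lebesgue_measure_set1.
    move=> x /= nx; apply: contrapT => /eqP xm; apply: nx => Sx.
    rewrite prodE// !mulf_neq0// ?(gt_eqF (f0 _ Sx))// subr_eq0//.
    have [lt|lt|/eqP] := ltgtP x m; last by rewrite (negbTE xm).
    + by rewrite lt_eqF// r_incr.
    + by rewrite gt_eqF// r_incr.
rewrite RintegralB ?RintegralZl ?centeredE//; try exact: centered_int.
rewrite mE subrr mulr0 subr0 subr_gt0 => mg.
by rewrite [ltRHS]/centroid mul1r mulrC ltr_pdivlMr.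
Qed.

Section normal_tilt.
Variables (R : realType) (sigma : R).
Hypothesis sigma0 : 0 < sigma.
Local Notation phi m := (normal_pdf m sigma).

Let sigma_neq0 : sigma != 0. Proof. by rewrite gt_eqF. Qed.

Lemma normal_pdf_gt0 m x : 0 < phi m x.
Proof. by rewrite normal_pdfE// mulr_gt0 ?normal_peak_gt0 ?expR_gt0. Qed.

(** Completing the square:
[a x - (x - m)^2 / (2 s^2)
 = a m + a^2 s^2 / 2 - (x - (m + a s^2))^2 / (2 s^2)]. *)
Lemma normal_pdf_tilt a m x :
  expR (a * x) * phi m x =
  expR (a * m + a ^+ 2 * sigma ^+ 2 / 2) * phi (m + a * sigma ^+ 2) x.
Proof.
rewrite !normal_pdfE// mulrCA [RHS]mulrCA; congr *%R.
rewrite /normal_fun -!expRD; congr expR.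
by field; rewrite sigma_neq0.
Qed.

Lemma ler_norm_expRD (x : R) : `|x| <= expR x + expR (- x).
Proof.
have := expR_ge1Dx x; have := expR_ge1Dx (- x).
have := expR_ge0 x; have := expR_ge0 (- x).
by rewrite ler_norml => *; apply/andP; split; lra.
Qed.

(** Domination by [(exp x + exp (- x)) * phi m x], which by tilting is a
combination of the densities of means [m + sigma^2] and [m - sigma^2]. *)
Lemma integrable_id_normal_pdf m :
  lebesgue_measure.-integrable setT (EFin \o (fun x => x * phi m x)).
Proof.
pose c a := expR (a * m + a ^+ 2 * sigma ^+ 2 / 2).
pose b x := c 1 * phi (m + 1 * sigma ^+ 2) x +
  c (- 1) * phi (m + (- 1) * sigma ^+ 2) x.
apply: (le_integrable (mu := lebesgue_measure) (g := EFin \o b)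
    (measurableT : measurable [set: measurableTypeR R])).
- apply/measurable_EFinP; apply: measurable_funM => //.
  exact: measurable_normal_pdf.
- move=> x _; rewrite lee_fin normrM (ger0_norm (normal_pdf_ge0 _ _ _)).
  rewrite (le_trans _ (ler_norm _))// /b /c -!normal_pdf_tilt mul1r mulN1r.
  by rewrite -mulrDl ler_wpM2r ?normal_pdf_ge0// ler_norm_expRD.
- by apply: integrable_EFinD => //; apply: integrable_EFinZl => //;
    exact: integrable_normal_pdf.
Qed.

Lemma centroid_normal_pdf_lt (m1 m2 : R) (S : set (measurableTypeR R)) :
  measurable S -> (0 < lebesgue_measure S)%E -> m1 < m2 ->
  centroid (phi m1) S < centroid (phi m2) S.
Proof.
move=> mS S0 m12.
have subint p : lebesgue_measure.-integrable setT (EFin \o p) ->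
    lebesgue_measure.-integrable S (EFin \o p).
  exact: integrableS.
(* The tilt that carries the mean m1 to the mean m2. *)
pose a := (m2 - m1) / sigma ^+ 2.
have a0 : 0 < a by rewrite divr_gt0 ?subr_gt0 ?exprn_gt0.
have m2E : m2 = m1 + a * sigma ^+ 2 by rewrite /a; field; rewrite sigma_neq0.
pose c := expR (a * m1 + a ^+ 2 * sigma ^+ 2 / 2).
have c0 : 0 < c by exact: expR_gt0.
apply: (@centroid_lt_of_increasing_ratio _ _ _ _
  (fun x => c^-1 * expR (a * x))) => //.
- by apply: subint; exact: integrable_normal_pdf.
- by apply: subint; exact: integrable_id_normal_pdf.
- by apply: subint; exact: integrable_normal_pdf.
- by apply: subint; exact: integrable_id_normal_pdf.
- by move=> x _; exact: normal_pdf_gt0.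
- by move=> x _; exact: normal_pdf_gt0.
- move=> x _; rewrite -mulrA normal_pdf_tilt -m2E -/c mulKf//.
  by rewrite gt_eqF.
- by move=> x y xy; rewrite ltr_pM2l ?invr_gt0// ltr_expR ltr_pM2l.
Qed.

End normal_tilt.

Lemma lebesgue_measure_setDitv_gt0 (R : realType) (l u : R) :
  (0 < (@lebesgue_measure R) ([set: R] `\` `]l, u[))%E.
Proof.
have sub : `]-oo, l] `<=` [set: R] `\` `]l, u[.
  move=> x /=; rewrite !in_itv/= => xl; split => //.
  by move=> /andP[]; rewrite ltNge xl.
apply: (@lt_le_trans _ _ (lebesgue_measure `]-oo, l])).
  by rewrite lebesgue_measure_itv/= ltNyr addey.
apply: (@le_measure _ _ _ (@lebesgue_measure R)) => //; rewrite inE.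
- exact: measurable_itv.
- by apply: measurableD => //; exact: measurable_itv.
Qed.

Theorem theorem1 (R : realType) (mu sigma : R) (hsigma : 0 < sigma) :
  let f : R -> R := fun x =>
    1 / Num.sqrt (2 * pi * sigma ^+ 2) *
    expR (- (1 / (2 * sigma ^+ 2)) * (x - mu) ^+ 2) in
  forall (h l u : R),
  let g : R -> R := fun x => f (x - h) in
  let S : set R := [set: R] `\` (`]l, u[) in
  0 < h -> u > l ->
  centroid g S > centroid f S.
Proof.
move=> f h l u g S h0 _.
have sigma0 : sigma != 0 by rewrite gt_eqF.
have fE : f = normal_pdf mu sigma.
  apply/funext => x; rewrite normal_pdfE// /f /normal_peak /normal_fun.
  rewrite div1r; congr (_^-1 * expR _); first by congr Num.sqrt; ring.
  by field; rewrite sigma0.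
have gE : g = normal_pdf (mu + h) sigma.
  apply/funext => x; rewrite /g fE !normal_pdfE// /normal_fun.
  by rewrite opprD addrA addrAC.
rewrite fE gE; apply: centroid_normal_pdf_lt => //.
- exact: measurableD.
- exact: lebesgue_measure_setDitv_gt0.
- by rewrite ltrDl.
Qed.
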